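(* $\mathbf{H}_{3,3}=\mathbf{H}_{3,4}=\varnothing$, $\mathbf{H}_{3,5}/O(6;\mathbb{R})$ is a singleton set, and (1) $\mathbf{H}_{3,6}/O(7;\mathbb{R})$ is bijective to the closure of a $1/4$-circle, and (2) $\mathbf{H}_{3,7}/O(8;\mathbb{R})$ is bijective to the closure of a $1/4$-disk.
   Context: $\mathcal{Q}_{n-1}=\{[z_0,\ldots,z_n]\in\mathbb{C}P^n: z_0^2+\cdots+z_n^2=0\}$. $Z_d:\mathbb{C}P^1\to\mathbb{C}P^d$ is the rational normal curve $Z_d([u,v])={}^t[u^d,\ldots,\binom di^{1/2}u^{d-i}v^i,\ldots,v^d]$. $\mathbf{H}_{d,n}$ is the set of $2$-spheres $EZ_d$ with $E$ a complex $(n+1)\times(d+1)$ matrix, $E^*E=Id_{d+1}$, and $EZ_d$ lying in $\mathcal{Q}_{n-1}$; these are the holomorphic $2$-spheres of constant curvature and degree $d$ in $\mathcal{Q}_{n-1}$. Two elements of $\mathbf{H}_{d,n}$ are equivalent if one is carried to the other by some $A\in O(n+1;\mathbb{R})$ together with some $SU(2)$-reparametrization of $\mathbb{C}P^1$; $\mathbf{H}_{d,n}/O(n+1;\mathbb{R})$ is the set of equivalence classes. *)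

(* Defs.v *)
From HB Require Import structures.
From mathcomp Require Import all_boot all_order all_algebra.
From mathcomp Require Import complex.
From mathcomp Require Import all_classical all_reals all_analysis.
Set Implicit Arguments.
Unset Strict Implicit.
Unset Printing Implicit Defensive.
Import Order.TTheory GRing.Theory Num.Theory.
Import numFieldNormedType.Exports.
Local Open Scope classical_set_scope.
Local Open Scope ring_scope.
Local Open Scope complex_scope.
Local Open Scope sesquilinear_scope.

(* CP^n is the set of one-dimensional subspaces of C^(n+1), C = R[i]. *)
Definition CP (R : realType) (n : nat) : Type :=
  {L : {vspace 'cV[R[i]]_n.+1} | \dim L == 1%N}.

Lemma dim_base (R : realType) (n : nat) :
  \dim <[const_mx 1%R : 'cV[R[i]]_n.+1]>%VS == 1%N.
Proof.
rewrite dim_vline; suff -> : const_mx 1%R != 0 :> 'cV[R[i]]_n.+1 by [].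
by apply/eqP => /matrixP /(_ 0 0) /eqP; rewrite !mxE oner_eq0.
Qed.

Definition CP_base (R : realType) (n : nat) : CP R n :=
  exist (fun L => \dim L == 1%N) _ (dim_base R n).

(* The point [z_0, ..., z_n]; the value at z = 0 is irrelevant. *)
Definition pt (R : realType) (n : nat) (z : 'cV[R[i]]_n.+1) : CP R n :=
  insubd (CP_base R n) <[z]>%VS.

(* A choice of homogeneous coordinates. *)
Definition coords (R : realType) (n : nat) (p : CP R n) : 'cV[R[i]]_n.+1 :=
  vpick (val p).

Lemma val_pt (R : realType) (n : nat) (z : 'cV[R[i]]_n.+1) :
  z != 0 -> val (pt z) = <[z]>%VS.
Proof. by move=> z0; rewrite val_insubd dim_vline z0. Qed.

Lemma coords_neq0 (R : realType) (n : nat) (p : CP R n) : coords p != 0.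
Proof.
rewrite vpick0 -dimv_eq0; have /eqP -> := valP p; exact: oner_neq0.
Qed.

Lemma coordsK (R : realType) (n : nat) (p : CP R n) : pt (coords p) = p.
Proof.
apply: val_inj; rewrite val_pt ?coords_neq0 //; apply/eqP.
rewrite eqEdim -memvE memv_pick dim_vline coords_neq0.
by have /eqP -> := valP p.
Qed.

Lemma pt_scale (R : realType) (n : nat) (c : R[i]) (z : 'cV[R[i]]_n.+1) :
  c != 0 -> z != 0 -> pt (c *: z) = pt z.
Proof.
move=> c0 z0; have cz0 : c *: z != 0 by rewrite scaler_eq0 negb_or c0.
apply: val_inj; rewrite !val_pt //; apply/eqP.
by rewrite eqEdim -memvE memvZ ?memv_line // !dim_vline z0 cz0.
Qed.

Lemma coords_pt (R : realType) (n : nat) (z : 'cV[R[i]]_n.+1) :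
  z != 0 -> exists2 c : R[i], c != 0 & coords (pt z) = c *: z.
Proof.
move=> z0; have : coords (pt z) \in <[z]>%VS by rewrite -val_pt // memv_pick.
case/vlineP=> c cE; exists c => //; apply: contraTneq (coords_neq0 (pt z)) => c0.
by rewrite cE c0 scale0r eqxx.
Qed.

Definition mxact (R : realType) (m n : nat) (M : 'M[R[i]]_(m.+1, n.+1))
    (p : CP R n) : CP R m :=
  pt (M *m coords p).

Lemma mxact_pt (R : realType) (m n : nat) (M : 'M[R[i]]_(m.+1, n.+1))
    (z : 'cV[R[i]]_n.+1) :
  z != 0 -> M *m z != 0 -> mxact M (pt z) = pt (M *m z).
Proof.
by move=> z0 Mz0; have [c c0 cE] := coords_pt z0; rewrite /mxact cE -scalemxAr pt_scale.
Qed.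

Definition quadric (R : realType) (n : nat) : set (CP R n) :=
  [set pt z | z in [set z : 'cV[R[i]]_n.+1 |
                     z != 0 /\ \sum_(i < n.+1) z i 0 ^+ 2 = 0]].
Arguments quadric : clear implicits.

Definition veronese (R : realType) (d : nat) (w : 'cV[R[i]]_2) :
    'cV[R[i]]_d.+1 :=
  \col_(i < d.+1)
    ((Num.sqrt ('C(d, i)%:R : R))%:C * w 0 0 ^+ (d - i) * w 1 0 ^+ i).

Definition rnc (R : realType) (d : nat) (p : CP R 1) : CP R d :=
  pt (veronese d (coords p)).

Lemma veronese_scale (R : realType) (d : nat) (c : R[i]) (w : 'cV[R[i]]_2) :
  veronese d (c *: w) = c ^+ d *: veronese d w.
Proof.
apply/colP => i; rewrite !mxE !exprMn.
have -> : c ^+ d = c ^+ (d - i) * c ^+ i by rewrite -exprD subnK // -ltnS.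
by rewrite [RHS]mulrACA (mulrCA _ (c ^+ (d - i))).
Qed.

Lemma veronese_neq0 (R : realType) (d : nat) (w : 'cV[R[i]]_2) :
  w != 0 -> veronese d w != 0.
Proof.
move=> w0; apply: contra_neq w0 => /colP vw.
have w00 : w 0 0 = 0.
  move: (vw ord0); rewrite !mxE bin0 sqrtr1 subn0 expr0 mulr1 mul1r => /eqP.
  by rewrite expf_eq0 => /andP[_ /eqP].
have w10 : w 1 0 = 0.
  move: (vw ord_max); rewrite !mxE binn sqrtr1 subnn expr0 mulr1 mul1r => /eqP.
  by rewrite expf_eq0 => /andP[_ /eqP].
apply/colP => i; rewrite !mxE; case: i => -[|[|//]] ilt.
  by rewrite -[RHS]w00; congr (w _ _); apply: val_inj.
by rewrite -[RHS]w10; congr (w _ _); apply: val_inj.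
Qed.

Lemma rnc_pt (R : realType) (d : nat) (w : 'cV[R[i]]_2) :
  w != 0 -> rnc d (pt w) = pt (veronese d w).
Proof.
move=> w0; have [c c0 cE] := coords_pt w0.
by rewrite /rnc cE veronese_scale pt_scale ?expf_neq0 ?veronese_neq0.
Qed.

(* Elements are parametrized spheres, i.e. maps CP^1 -> CP^n and not their
   images: the reparametrizations are quotiented out in [sphere_equiv]. *)
Definition H (R : realType) (d n : nat) : set (CP R 1 -> CP R n) :=
  [set f | (exists2 E : 'M[R[i]]_(n.+1, d.+1),
              E ^t* *m E = 1%:M & f = mxact E \o @rnc R d)
           /\ range f `<=` quadric R n].
Arguments H : clear implicits.

Definition is_O (R : realType) (n : nat) (A : 'M[R]_n) : Prop :=
  A^T *m A = 1%:M.

Definition is_SU2 (R : realType) (U : 'M[R[i]]_2) : Prop :=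
  U \is unitarymx /\ \det U = 1.

Definition sphere_equiv (R : realType) (n : nat) (f g : CP R 1 -> CP R n) :
    Prop :=
  exists A : 'M[R]_n.+1, exists U : 'M[R[i]]_2,
    [/\ is_O A, is_SU2 U &
        g = mxact (map_mx (real_complex R) A) \o f \o mxact U].

Definition moduli (R : realType) (d n : nat) : set (set (CP R 1 -> CP R n)) :=
  [set [set g | H R d n g /\ sphere_equiv f g] | f in H R d n].
Arguments moduli : clear implicits.

(* The open arc and the open sector; the statement takes their closures. *)
Definition quarter_circle (R : realType) : set (R * R) :=
  [set p | [/\ 0 < p.1, 0 < p.2 & p.1 ^+ 2 + p.2 ^+ 2 = 1]].
Arguments quarter_circle : clear implicits.

Definition quarter_disk (R : realType) : set (R * R) :=
  [set p | [/\ 0 < p.1, 0 < p.2 & p.1 ^+ 2 + p.2 ^+ 2 < 1]].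
Arguments quarter_disk : clear implicits.

Definition bijective_to (T U : Type) (A : set T) (B : set U) : Prop :=
  exists phi : T -> U, set_bij A B phi.

(* Main.v *)
From mathcomp Require Import all_boot all_order all_algebra.
From mathcomp Require Import complex ring lra.
From mathcomp Require Import all_classical all_reals all_analysis.
Require Import Defs.
Import Order.TTheory GRing.Theory Num.Theory.
Import numFieldNormedType.Exports.
Set Implicit Arguments.
Unset Strict Implicit.
Unset Printing Implicit Defensive.
Local Open Scope classical_set_scope.
Local Open Scope ring_scope.

(** Write a sphere of degree 3 as w |-> [F m(w)], where m(u, v) is the vector
    (u^3, u^2 v, u v^2, v^3) and the columns of F are hermitian orthogonal of
    square norms 1, 3, 3, 1 ([isometric]).  Left multiplication by O(n+1) is
    controlled by the Gram matrices of F: two real frames with the same inner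
    products differ by an orthogonal matrix ([gram_orthogonal]), so up to
    O(n+1) the frame F is determined by the complex symmetric matrix
    P = F^T F.

    The sphere lies in the quadric exactly when the quadratic form
    m(w)^T P m(w) vanishes.  As a representation of SU(2), the symmetric forms
    on binary cubics are Sym^6 + Sym^2, and this condition kills the Sym^6
    part.  Hence P is the image [cubic_form] S of a symmetric 2 x 2 matrix S
    ([cubic_formP]); concretely
    m(w1)^T (cubic_form S) m(w2) = det(w1, w2)^2 (w1^T S w2),
    from which the equivariance of S under reparametrization is immediate.

    A reparametrization by U in SU(2) replaces S by U^T S U, and rescaling F
    by a phase c, which does not change the sphere, replaces S by c^2 S.
    Takagi's factorization ([takagi]) brings S to diag(x, z) with
    x >= z >= 0, and x, z are invariants because they are the singular values
    of S.  So the moduli space is the set of pairs (x, z) that occur in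
    dimension n+1.

    When P is real, the real and the imaginary parts of F span orthogonal
    subspaces, with Gram matrices half the sum and half the difference of
    diag(1, 3, 3, 1) and P.  These split into 2 x 2 blocks, so an explicit
    unipotent change of basis diagonalizes them, with eight pivots:
    four constants, and half of each of 3 - 2x - z^2, 3 - 2z - x^2,
    3 + 2x - z^2, 3 + 2z - x^2.  A diagonal Gram matrix is realized in R^(n+1)
    if and only if its entries are nonnegative and at most n+1 of them are
    nonzero.  For x >= z >= 0 this says z^2 + 2x <= 3, with six pivots always
    positive, the pivot 3 - 2x - z^2 being the first to vanish and
    3 - 2z - x^2 vanishing only at x = z = 1 ([frame_domainP]).  Therefore
    nothing occurs for n+1 <= 5, only (1, 1) for n+1 = 6, the arc
    z^2 + 2x = 3 for n+1 = 7, and the whole region for n+1 = 8.  The map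
    [straighten] carries the closed quarter circle onto the arc and the closed
    quarter disk onto the region. *)

(** * The bilinear form on binary cubics attached to a symmetric matrix *)
Section BinaryForms.
Variable T : comNzRingType.
Implicit Types (w : 'cV[T]_2) (U S : 'M[T]_2).

Definition mx4 (s : seq (seq T)) : 'M[T]_4 := \matrix_(i, j) (nth [::] s i)`_j.

Definition monomials w : 'cV[T]_4 := \col_i (w 0 0 ^+ (3 - i) * w 1 0 ^+ i).

(** The matrix of the third symmetric power of U in the monomial basis. *)
Definition sym3 U : 'M[T]_4 :=
  let a := U 0 0 in let b := U 0 1 in let c := U 1 0 in let d := U 1 1 in
  mx4 [:: [:: a ^+ 3; 3 * a ^+ 2 * b; 3 * a * b ^+ 2; b ^+ 3];
          [:: a ^+ 2 * c; a ^+ 2 * d + 2 * a * b * c;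
              2 * a * b * d + b ^+ 2 * c; b ^+ 2 * d];
          [:: a * c ^+ 2; 2 * a * c * d + b * c ^+ 2;
              a * d ^+ 2 + 2 * b * c * d; b * d ^+ 2];
          [:: c ^+ 3; 3 * c ^+ 2 * d; 3 * c * d ^+ 2; d ^+ 3]].

(** Up to scaling the only SL(2)-equivariant map from quadratic forms to
    quadratic forms on cubics; [cubic_formE] is where these entries come from. *)
Definition cubic_form S : 'M[T]_4 :=
  let x := S 0 0 in let y := S 0 1 in let z := S 1 1 in
  mx4 [:: [:: 0; 0; x; y]; [:: 0; - (2 * x); - y; z];
          [:: x; - y; - (2 * z); 0]; [:: y; z; 0; 0]].

(** The Gram matrix of the monomials for the SU(2)-invariant hermitian
    product, up to normalization. *)
Definition binom3 : 'M[T]_4 := diag_mx (\row_i 'C(3, i)%:R).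

Lemma monomials_mul U w : monomials (U *m w) = sym3 U *m monomials w.
Proof.
apply/colP => i; rewrite !mxE !big_ord_recl !big_ord0 !mxE /=.
have -> : lift ord0 (ord0 : 'I_1) = 1 :> 'I_2 by apply: val_inj.
by case: i => [[|[|[|[|//]]]] ?] /=; ring.
Qed.

Lemma monomialsZ c w : monomials (c *: w) = c ^+ 3 *: monomials w.
Proof.
by apply/colP => i; rewrite !mxE; case: i => [[|[|[|[|//]]]] ?] /=; ring.
Qed.

(** The factor det(w1, w2)^2 makes the form vanish on the diagonal and shows at
    once how it transforms under a linear substitution. *)
Lemma cubic_formE S w1 w2 : S^T = S ->
  (monomials w1)^T *m cubic_form S *m monomials w2 =
  (w1 0 0 * w2 1 0 - w1 1 0 * w2 0 0) ^+ 2 *: (w1^T *m S *m w2).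
Proof.
move=> /matrixP /(_ 1 0); rewrite mxE => yE.
apply/matrixP => i j; rewrite !ord1 !mxE !(big_ord_recl, big_ord0) !mxE.
rewrite !(big_ord_recl, big_ord0) !mxE /=.
have -> : lift ord0 (ord0 : 'I_1) = 1 :> 'I_2 by apply: val_inj.
rewrite -yE; ring.
Qed.

End BinaryForms.

Section Separation.
Variable T : numDomainType.
Implicit Types (w : 'cV[T]_2).

Definition vec2 (a b : T) : 'cV[T]_2 := \col_i [:: a; b]`_i.
Definition mx2 (a b c d : T) : 'M[T]_2 :=
  \matrix_(i, j) (nth [::] [:: [:: a; b]; [:: c; d]] i)`_j.

(** The characteristic is zero, so there are more points than any degree. *)
Lemma poly_eq0_horner (p : {poly T}) : (forall t, p.[t] = 0) -> p = 0.
Proof.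
move=> p0; apply/eqP/negPn/negP => pN0.
have /(max_poly_roots pN0) : all (root p) [seq n%:R | n <- iota 0 (size p)].
  by apply/allP => t _; rewrite rootE p0.
rewrite map_inj_uniq ?iota_uniq ?size_map ?size_iota ?ltnn; last first.
  by move=> m n /eqP; rewrite eqr_nat => /eqP.
by move=> /(_ isT).
Qed.

(** The rational normal curve spans the whole space: a row that kills it is a
    cubic polynomial with infinitely many roots. *)
Lemma monomials_sep k (M N : 'M[T]_(k, 4)) :
  (forall t, M *m monomials (vec2 1 t) = N *m monomials (vec2 1 t)) -> M = N.
Proof.
move=> MN; apply/matrixP => i j; apply/eqP; rewrite -subr_eq0; apply/eqP.
have /poly_eq0_horner p0 : forall t,
    (\poly_(j < 4) (M i (inord j) - N i (inord j))).[t] = 0.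
  move=> t; rewrite horner_poly; have /matrixP /(_ i 0) := MN t.
  rewrite !mxE => /eqP; rewrite -subr_eq0 -sumrB => /eqP {2}<-.
  apply: eq_bigr => l _; rewrite !mxE /= expr1n mul1r inord_val; ring.
have /(congr1 (fun p : {poly T} => p`_j)) := p0.
by rewrite coef_poly ltn_ord inord_val coef0.
Qed.

Lemma sym3M (U V : 'M[T]_2) : sym3 (U *m V) = sym3 U *m sym3 V.
Proof. by apply: monomials_sep => t; rewrite -mulmxA -!monomials_mul mulmxA. Qed.

Lemma sym31 : sym3 (1%:M : 'M[T]_2) = 1%:M.
Proof. by apply: monomials_sep => t; rewrite -monomials_mul !mul1mx. Qed.

Lemma monomials_sep2 (M N : 'M[T]_4) :
  (forall s t, (monomials (vec2 1 s))^T *m M *m monomials (vec2 1 t) =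
               (monomials (vec2 1 s))^T *m N *m monomials (vec2 1 t)) -> M = N.
Proof.
move=> MN; apply: trmx_inj; apply: monomials_sep => s; apply: trmx_inj.
rewrite !trmx_mul !trmxK.
by apply: monomials_sep => t; exact: MN.
Qed.

Lemma det2 (U : 'M[T]_2) : \det U = U 0 0 * U 1 1 - U 0 1 * U 1 0.
Proof.
rewrite (expand_det_row _ 0) !big_ord_recl big_ord0 /cofactor /= !det_mx11 !mxE.
have -> : lift ord0 (ord0 : 'I_1) = 1 :> 'I_2 by apply: val_inj.
have -> : lift 1 (0 : 'I_1) = 0 :> 'I_2 by apply: val_inj.
rewrite /=; ring.
Qed.

(** Both sides have the same values on pairs of points of the rational normal
    curve, by two uses of [cubic_formE]. *)
Lemma cubic_form_sym3 (U S : 'M[T]_2) : S^T = S ->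
  (sym3 U)^T *m cubic_form S *m sym3 U = \det U ^+ 2 *: cubic_form (U^T *m S *m U).
Proof.
move=> SE; apply: monomials_sep2 => s t.
rewrite -scalemxAr -scalemxAl cubic_formE; last by rewrite !trmx_mul SE trmxK mulmxA.
rewrite !mulmxA -trmx_mul -monomials_mul -[_ *m sym3 U *m _]mulmxA.
rewrite -monomials_mul cubic_formE //.
rewrite scalerA !mulmxA trmx_mul; congr (_ *: _).
rewrite det2 !mxE !(big_ord_recl, big_ord0) !mxE /=.
have -> : lift ord0 (ord0 : 'I_1) = 1 :> 'I_2 by apply: val_inj.
ring.
Qed.

(** The coefficients of the sextic m(1, t)^T P m(1, t) give seven linear
    equations on the ten entries of P; the three entries left free are those
    of S. *)
Lemma cubic_formP (P : 'M[T]_4) : P^T = P ->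
  (forall t, (monomials (vec2 1 t))^T *m P *m monomials (vec2 1 t) = 0) ->
  exists2 S : 'M[T]_2, S^T = S & P = cubic_form S.
Proof.
move=> Psym P0.
(* The coefficient of t^k is the sum of an antidiagonal of P. *)
pose c k : T := \sum_(i < 4) \sum_(j < 4) if (i + j == k)%N then P i j else 0.
have /poly_eq0_horner p0 : forall t, (\poly_(k < 7) c k).[t] = 0.
  move=> t; have /matrixP /(_ 0 0) := P0 t; rewrite [RHS]mxE => <-.
  rewrite horner_poly !mxE !(big_ord_recl, big_ord0) !mxE.
  rewrite !(big_ord_recl, big_ord0) !mxE /c.
  rewrite !(big_ord_recl, big_ord0) /=; ring.
have cE k : (k < 7)%N -> c k = 0.
  move=> k7; have /(congr1 (fun p : {poly T} => p`_k)) := p0.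
  by rewrite coef_poly k7 coef0.
have sE i j : P j i = P i j by rewrite -[in RHS]Psym mxE.
pose p i j := P (inord i) (inord j).
have pE (i j : 'I_4) : P i j = p i j by rewrite /p !inord_val.
have pC i j : p i j = p j i by rewrite /p sE.
exists (mx2 (p 0 2)%N (p 0 3)%N (p 0 3)%N (p 1 3)%N).
  by apply/matrixP => -[[|[|//]] ?] [[|[|//]] ?]; rewrite !mxE.
have half x : x *+ 2 = 0 -> x = 0 :> T.
  by move=> /eqP; rewrite mulrn_eq0 => /eqP.
have := (cE 0 isT, cE 1 isT, cE 2 isT, cE 3 isT, cE 4 isT, cE 5 isT, cE 6 isT)%N.
rewrite /c !(big_ord_recl, big_ord0) /= !pE /= /bump /= !add0r !addr0.
rewrite (pC 1 0)%N (pC 2 0)%N (pC 3 0)%N (pC 2 1)%N (pC 3 1)%N (pC 3 2)%N.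
move=> [[[[[[c0 c1] c2] c3] c4] c5] c6].
have p01 : p 0 1 = 0 by apply: half; rewrite mulr2n.
have p23 : p 2 3 = 0 by apply: half; rewrite mulr2n.
have p11 : p 1 1 = - (2 * p 0 2).
  by apply/eqP; rewrite -addr_eq0 -[X in _ == X]c2; apply/eqP; ring.
have p22 : p 2 2 = - (2 * p 1 3).
  by apply/eqP; rewrite -addr_eq0 -[X in _ == X]c4; apply/eqP; ring.
have p12 : p 1 2 = - p 0 3.
  by apply/eqP; rewrite -addr_eq0; apply/eqP/half; rewrite -[RHS]c3; ring.
by apply/matrixP => i j; rewrite pE !mxE /=;
   case: i => [[|[|[|[|//]]]] ?]; case: j => [[|[|[|[|//]]]] ?] //=;
   rewrite ?(pC 1 0)%N ?(pC 2 0)%N ?(pC 3 0)%N ?(pC 2 1)%N ?(pC 3 1)%N ?(pC 3 2)%N.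
Qed.

End Separation.

(** * Unitary matrices and the Takagi factorization *)
Section Hermitian.
Local Open Scope sesquilinear_scope.
Variable C : numClosedFieldType.
Implicit Types (U V S : 'M[C]_2).

Lemma ord2_ind (P : 'I_2 -> Prop) : P 0 -> P 1 -> forall i, P i.
Proof.
by move=> P0 P1 [[|[|//]] h]; [move: P0|move: P1]; congr (P _); apply: val_inj.
Qed.

Lemma big_ord2 (F : 'I_2 -> C) : \sum_i F i = F 0 + F 1.
Proof.
rewrite !big_ord_recl big_ord0 addr0; congr (_ + F _); exact: val_inj.
Qed.

(** The third symmetric power commutes with adjunction for the invariant
    hermitian product, which is what makes it unitary on unitary matrices. *)
Lemma sym3_adj U : (sym3 U)^t* *m binom3 C = binom3 C *m sym3 (U^t*).
Proof.
rewrite /binom3 mul_mx_diag mul_diag_mx; apply/matrixP => i j; rewrite !mxE.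
by case: i => [[|[|[|[|//]]]] ?]; case: j => [[|[|[|[|//]]]] ?];
  rewrite /= ?[in 'C(_, _)]/binomial /=
    ?(rmorphD, rmorphM, rmorphXn, rmorph_nat) /=; ring.
Qed.

Lemma sym3_unitary U : U \is unitarymx ->
  (sym3 U)^t* *m binom3 C *m sym3 U = binom3 C.
Proof.
move=> Uu; rewrite sym3_adj -mulmxA -sym3M.
by rewrite -[U^t* *m U]mul1mx mulmxA mulmxKtV // sym31 mulmx1.
Qed.

Lemma sqnorm2_gt0 (u : 'rV[C]_2) : u != 0 -> 0 < `|u 0 0| ^+ 2 + `|u 0 1| ^+ 2.
Proof.
move=> u0; rewrite lt0r addr_ge0 ?exprn_ge0 // andbT.
rewrite paddr_eq0 ?exprn_ge0 // !expf_eq0 /= !normr_eq0.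
apply: contra u0 => /andP[/eqP u00 /eqP u01]; apply/eqP/matrixP => i j.
by rewrite ord1 mxE; elim/ord2_ind: j.
Qed.

(** The antilinear map J u = conj (u S) has square u |-> u S (S adjoint), which
    is positive.  If J^2 v = s^2 v with s >= 0, then J v + s v is fixed by J up
    to the factor s; when that vector is zero, J v = - s v and multiplication
    by the imaginary unit changes the sign. *)
Lemma con_eigenvector S : S^T = S ->
  exists2 u : 'rV[C]_2, u != 0 &
  exists2 s, 0 <= s & u *m S = s *: map_mx Num.conj u.
Proof.
move=> SE; pose J (u : 'rV[C]_2) := map_mx Num.conj (u *m S).
have ScE : S^t* = map_mx Num.conj S by rewrite SE.
have [t /eigenvalueP [v vE v0]] := @eigenvalue_closed C 2 (S *m S^t*) isT.
have nrm (u : 'rV[C]_2) : (u *m u^t*) 0 0 = `|u 0 0| ^+ 2 + `|u 0 1| ^+ 2.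
  by rewrite !mxE big_ord2 !mxE !normCK.
have nrm_gt0 : 0 < (v *m v^t*) 0 0 by rewrite nrm sqnorm2_gt0.
have t0 : 0 <= t.
  rewrite -(pmulr_lge0 _ nrm_gt0).
  have -> : t * (v *m v^t*) 0 0 = (v *m S *m (v *m S)^t*) 0 0.
    by rewrite trmx_mul map_mxM mulmxA -[v *m S *m _]mulmxA vE -scalemxAl [RHS]mxE.
  by rewrite nrm addr_ge0 ?exprn_ge0.
pose s := sqrtC t; have s0 : 0 <= s by rewrite sqrtC_ge0.
have sK : s^* = s by apply/CrealP/ger0_real.
have cK (M : 'rV[C]_2) : map_mx Num.conj (map_mx Num.conj M) = M.
  by apply/matrixP => i j; rewrite !mxE conjCK.
have JJ : J (J v) = t *: v.
  by rewrite /J map_mxM cK -mulmxA -ScE.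
have JD u u' : J (u + u') = J u + J u' by rewrite /J mulmxDl map_mxD.
have JZ c u : J (c *: u) = c^* *: J u by rewrite /J -scalemxAl map_mxZ.
suff [u u0 uE] : exists2 u, u != 0 & J u = s *: u.
  by exists u => //; exists s => //; rewrite -sK -map_mxZ -uE cK.
have [Jv|w0] := eqVneq (J v + s *: v) 0; last first.
  by exists (J v + s *: v) => //; rewrite JD JZ JJ sK scalerDr scalerA addrC -expr2 sqrtCK.
exists ('i *: v); first by rewrite scaler_eq0 negb_or neq0Ci.
rewrite JZ conjCi; move/eqP: Jv; rewrite addr_eq0 => /eqP ->.
by rewrite scaleNr scalerN opprK !scalerA mulrC.
Qed.

(** Let u be a unit con-eigenvector.  Since u S is proportional to conj u, a
    vector orthogonal to u for the hermitian product is also orthogonal to it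
    for the bilinear form S, so a unitary basis starting with u diagonalizes S. *)
Lemma takagi_diag S : S^T = S ->
  exists2 V, V \is unitarymx &
  exists2 s, 0 <= s & exists t, V^T *m S *m V = mx2 s 0 0 t.
Proof.
move=> SE; have [u u0 [s s0 us]] := con_eigenvector SE.
pose n2 := `|u 0 0| ^+ 2 + `|u 0 1| ^+ 2.
have n2_gt0 : 0 < n2 := sqnorm2_gt0 u0.
pose n := sqrtC n2; have n_gt0 : 0 < n by rewrite sqrtC_gt0.
have nN0 : n != 0 by rewrite gt_eqF.
have nK : (n^-1)^* = n^-1 by apply/CrealP; rewrite realV gtr0_real.
pose a := u 0 0 / n; pose b := u 0 1 / n.
have ab : a * a^* + b * b^* = 1.
  rewrite /a /b !rmorphM /= nK !(mulrACA _ n^-1) -mulrDl -!normCK -/n2.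
  by rewrite -[n2]sqrtCK -/n expr2 mulrACA divff // mulr1.
have yE : S 1 0 = S 0 1 by rewrite -[in LHS]SE mxE.
have e0 : a * S 0 0 + b * S 0 1 = s * a^*.
  have /matrixP /(_ 0 0) := us; rewrite !mxE big_ord2 yE => us0.
  by rewrite /a rmorphM /= nK mulrA -us0 /b; ring.
have e1 : a * S 0 1 + b * S 1 1 = s * b^*.
  have /matrixP /(_ 0 1) := us; rewrite !mxE big_ord2 => us1.
  by rewrite /b rmorphM /= nK mulrA -us1 /a; ring.
pose V := mx2 a (- b^*) b a^*.
exists V.
  rewrite -trmxC_unitary; apply/unitarymxP; rewrite trmxCK.
  apply/matrixP; do 2! elim/ord2_ind; rewrite !mxE big_ord2 !mxE /=;
    rewrite ?rmorphN /= ?conjCK; try (by ring);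
    rewrite -ab; ring.
exists s => //; exists ((V^T *m S *m V) 1 1).
apply/matrixP; do 2! elim/ord2_ind;
  rewrite [RHS]mxE // !mxE !big_ord2 !mxE !big_ord2 !mxE /= ?yE.
- transitivity ((a * S 0 0 + b * S 0 1) * a + (a * S 0 1 + b * S 1 1) * b); first by ring.
  rewrite e0 e1 -[s in RHS]mulr1 -ab; ring.
- rewrite e0 e1; ring.
- transitivity (- b^* * (a * S 0 0 + b * S 0 1) +
                  a^* * (a * S 0 1 + b * S 1 1)); first by ring.
  rewrite e0 e1; ring.
Qed.

(** The remaining diagonal entry is made nonnegative by a phase and the two
    entries are sorted by a swap. *)
Lemma takagi S : S^T = S ->
  exists2 V, V \is unitarymx &
  exists x z, [/\ 0 <= z, z <= x & V^T *m S *m V = mx2 x 0 0 z].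
Proof.
move=> SE; have [V Vu [s s0 [t VS]]] := takagi_diag SE.
have [m mN mt] : exists2 m : C, m * m^* = 1 & m ^+ 2 * t = `|t|.
  have [->|tN0] := eqVneq t 0.
    by exists 1; rewrite ?rmorph1 ?mulr1 // normr0 mulr0.
  exists (sqrtC (`|t| / t)); last by rewrite sqrtCK divfK.
  rewrite -normCK -normrX sqrtCK normf_div normr_id divff //.
  by rewrite normr_eq0.
have VW W : (V *m W)^T *m S *m (V *m W) = W^T *m mx2 s 0 0 t *m W.
  by rewrite trmx_mul -VS !mulmxA.
have [ts|/ltW st] : `|t| <= s \/ s < `|t|.
  have : s >=< `|t| by apply: real_comparable; apply: ger0_real.
  by case/comparable_ltgtP; [right|left|left].
- exists (V *m mx2 1 0 0 m).
    apply: mul_unitarymx => //; apply/unitarymxP/matrixP.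
    by do 2! elim/ord2_ind; rewrite !mxE big_ord2 !mxE /=;
      rewrite ?rmorph0 ?rmorph1 ?mN; ring.
  exists s, `|t|; split => //; rewrite VW.
  apply/matrixP; do 2! elim/ord2_ind; rewrite !mxE big_ord2 !mxE !big_ord2 !mxE /=;
  rewrite -?mt; ring.
- exists (V *m mx2 0 1 m 0).
    apply: mul_unitarymx => //; apply/unitarymxP/matrixP.
    by do 2! elim/ord2_ind; rewrite !mxE big_ord2 !mxE /=;
      rewrite ?rmorph0 ?rmorph1 ?mN; ring.
  exists `|t|, s; split => //; rewrite VW.
  apply/matrixP; do 2! elim/ord2_ind; rewrite !mxE big_ord2 !mxE !big_ord2 !mxE /=;
  rewrite -?mt; ring.
Qed.

End Hermitian.

(** * Gram matrices over a real closed field *)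
Section RealGram.
Variable R : rcfType.

Definition dot m (u v : 'cV[R]_m) : R := (u^T *m v) 0 0.

Lemma dot_eq0 m (d : 'cV[R]_m) : dot d d = 0 -> d = 0.
Proof.
rewrite /dot mxE => /eqP; under eq_bigr do rewrite mxE -expr2.
rewrite psumr_eq0 => [/allP d0|i _]; last by rewrite sqr_ge0.
apply/colP => i; rewrite mxE; apply/eqP; rewrite -sqrf_eq0.
by apply: d0; rewrite mem_index_enum.
Qed.

Lemma dotC m (u v : 'cV[R]_m) : dot u v = dot v u.
Proof. by rewrite /dot !mxE; apply: eq_bigr => i _; rewrite !mxE mulrC. Qed.

Lemma dotBl m (u v w : 'cV[R]_m) : dot (u - v) w = dot u w - dot v w.
Proof. by rewrite /dot linearB /= mulmxBl mxE [X in _ + X]mxE. Qed.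

Lemma dotBr m (u v w : 'cV[R]_m) : dot w (u - v) = dot w u - dot w v.
Proof. by rewrite !(dotC w) dotBl. Qed.

Definition reflection m (d : 'cV[R]_m) : 'M[R]_m :=
  1%:M - (2 / dot d d) *: (d *m d^T).

Lemma reflectionE m (d u : 'cV[R]_m) :
  reflection d *m u = u - (2 / dot d d * dot d u) *: d.
Proof.
rewrite mulmxBl mul1mx -scalemxAl -mulmxA; congr (_ - _).
by rewrite [d^T *m u]mx11_scalar mul_mx_scalar scalerA.
Qed.

Lemma reflection_orthogonal m (d : 'cV[R]_m) : d != 0 ->
  (reflection d)^T *m reflection d = 1%:M.
Proof.
move=> d0; have dd0 : dot d d != 0 by apply: contra d0 => /eqP /dot_eq0 ->.
have -> : (reflection d)^T = reflection d.
  by rewrite /reflection linearB linearZ /= trmx1 trmx_mul trmxK.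
have rd : reflection d *m d = - d.
  by rewrite reflectionE divfK // scaler_nat mulr2n opprD addrA subrr sub0r.
by rewrite {2}/reflection mulmxBr mulmx1 -scalemxAr mulmxA rd mulNmx scalerN opprK subrK.
Qed.

(** The hyperplane bisecting two vectors of equal length exchanges them. *)
Lemma reflection_swap m (u v : 'cV[R]_m) : u != v -> dot u u = dot v v ->
  reflection (u - v) *m u = v.
Proof.
move=> uv nuv; rewrite reflectionE.
have dd0 : dot (u - v) (u - v) != 0.
  by apply: contra uv => /eqP /dot_eq0 /eqP; rewrite subr_eq0.
have -> : 2 / dot (u - v) (u - v) * dot (u - v) u = 1; last first.
  by rewrite scale1r opprB addrC subrK.
rewrite mulrAC; apply: (canLR (mulfK dd0)).
rewrite mul1r dotBl !dotBr !dotBl (dotC v u) nuv; ring.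
Qed.

(** Witt extension: the columns are matched one after the other.  The
    reflection that corrects the next column fixes the columns already matched,
    because they have the same inner products with the two vectors exchanged. *)
Lemma gram_orthogonal m k (K L : 'M[R]_(m, k)) : K^T *m K = L^T *m L ->
  exists2 A : 'M[R]_m, A^T *m A = 1%:M & L = A *m K.
Proof.
move=> KL.
have gram (M : 'M[R]_(m, k)) i j : dot (col i M) (col j M) = (M^T *m M) i j.
  by rewrite /dot !mxE; apply: eq_bigr => l _; rewrite !mxE.
suff /(_ k) [A Ao AK] : forall j : nat, exists2 A : 'M[R]_m, A^T *m A = 1%:M &
    forall i : 'I_k, (i < j)%N -> A *m col i K = col i L.
  exists A => //; apply/matrixP => i j.
  have := AK j (ltn_ord j); rewrite !colE mulmxA -!colE => /colP /(_ i).
  have colE' (M : 'M[R]_(m, k)) : col j M i 0 = M i j by rewrite mxE.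
  by rewrite !colE'.
elim => [|j [A Ao AK]]; first by exists 1%:M; rewrite ?trmx1 ?mulmx1.
have [kj|jk] := leqP k j.
  by exists A => // i _; apply: AK; apply: leq_trans kj.
pose J := Ordinal jk; pose u := A *m col J K; pose v := col J L.
have dotA i i' : dot (A *m col i K) (A *m col i' K) =
    dot (col i L) (col i' L).
  by rewrite gram -KL -gram /dot trmx_mul mulmxA -[_ *m A]mulmxA Ao mulmx1.
have [uv|uv] := eqVneq u v.
  exists A => // i; rewrite ltnS leq_eqVlt => /orP[/eqP ij|]; last exact: AK.
  by have -> : i = J by apply: val_inj.
exists (reflection (u - v) *m A).
  rewrite trmx_mul mulmxA -[_ *m reflection _]mulmxA reflection_orthogonal ?mulmx1 //.
  by rewrite subr_eq0.
move=> i; rewrite ltnS leq_eqVlt => /orP[/eqP ij|ij].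
  have -> : i = J by apply: val_inj.
  by rewrite -mulmxA reflection_swap // dotA.
rewrite -mulmxA AK // reflectionE.
have -> : dot (u - v) (col i L) = 0; last by rewrite mulr0 scale0r subr0.
by rewrite dotBl -{1}(AK i ij) dotA subrr.
Qed.

(** The columns with nonzero pivot are orthogonal and nonzero, hence free. *)
Lemma gram_diag_rank m k (K : 'M[R]_(m, k)) (d : 'rV[R]_k) :
  K^T *m K = diag_mx d -> (#|[pred j | d 0%R j != 0%R]| <= m)%N.
Proof.
set S := [pred j | _] => KK.
pose L := colsub (@enum_val _ S) K.
have LL : L^T *m L = diag_mx (\row_i d 0 (enum_val i)).
  apply/matrixP => i j; have /matrixP /(_ (enum_val i) (enum_val j)) := KK.
  rewrite !mxE (inj_eq enum_val_inj) => <-.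
  by apply: eq_bigr => l _; rewrite !mxE.
have : row_free (L^T *m L).
  rewrite row_free_unit LL unitmxE det_diag unitfE; apply/prodf_neq0 => i _.
  by rewrite mxE; have := enum_valP i.
by move=> /eqP rLL; have := mulmx_max_rank L^T L; rewrite rLL.
Qed.

(** Distinct basis vectors, scaled, are given to the nonzero pivots. *)
Lemma gram_diag_exists m k (d : 'rV[R]_k) : (forall j, 0 <= d 0 j) ->
  (#|[pred j | d 0%R j != 0%R]| <= m)%N -> exists K : 'M[R]_(m, k), K^T *m K = diag_mx d.
Proof.
set S := [pred j | _] => d0 Sm.
exists (\matrix_(i, j) ((i == index j (enum S) :> nat)%:R * Num.sqrt (d 0 j))).
apply/matrixP => i j; rewrite !mxE; under eq_bigr do rewrite !mxE.
have [iS|/negPn/eqP di] := boolP (i \in S); last first.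
  by rewrite big1 ?di ?mul0rn // => l _; rewrite sqrtr0 mulr0 mul0r.
have ilt : (index i (enum S) < m)%N.
  by apply: leq_trans Sm; rewrite cardE index_mem mem_enum.
rewrite (bigD1 (Ordinal ilt)) //= eqxx mul1r big1 ?addr0 => [|l lN]; last first.
  by rewrite (negPf (lN : (l != _ :> nat))) !mul0r.
have [->|ij] := eqVneq i j.
  by rewrite eqxx mul1r mulr1n -expr2 sqr_sqrtr.
rewrite mulr0n; case: eqP => [e|_]; last by rewrite mul0r mulr0.
case/eqP: ij; have jS : j \in enum S by rewrite -index_mem -e index_mem mem_enum.
by rewrite -(nth_index i jS) -e nth_index // mem_enum.
Qed.

End RealGram.

(** * Real and imaginary parts of complex frames *)
Section RealParts.
Local Open Scope complex_scope.
Local Open Scope sesquilinear_scope.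
Variable R : realType.
Local Notation C := R[i].
Local Notation rc := (map_mx (real_complex R)).

Definition real_parts m k (F : 'M[C]_(m, k)) : 'M[R]_(m, k + k) :=
  row_mx (map_mx (@complex.Re R) F) (map_mx (@complex.Im R) F).

Lemma real_partsE m k (F : 'M[C]_(m, k)) :
  F = rc (lsubmx (real_parts F)) + 'i *: rc (rsubmx (real_parts F)).
Proof. by rewrite row_mxKl row_mxKr; apply/matrixP => i j; rewrite !mxE [LHS]complexE. Qed.

Lemma real_partsK m k (K : 'M[R]_(m, k + k)) :
  real_parts (rc (lsubmx K) + 'i *: rc (rsubmx K)) = K.
Proof.
rewrite -[RHS]hsubmxK; congr row_mx; apply/matrixP => i j; rewrite !mxE /=;
  by rewrite !(mul0r, mulr0, mul1r, addr0, subr0, add0r).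
Qed.

Lemma real_parts_mul m n k (A : 'M[R]_(m, n)) (F : 'M[C]_(n, k)) :
  real_parts (rc A *m F) = A *m real_parts F.
Proof.
rewrite {1}[F]real_partsE mulmxDr -scalemxAr -!map_mxM -[RHS]real_partsK.
by rewrite -mulmx_lsub -mulmx_rsub.
Qed.

Lemma rc_inj m k (X Y X' Y' : 'M[R]_(m, k)) :
  rc X + 'i *: rc Y = rc X' + 'i *: rc Y' -> X = X' /\ Y = Y'.
Proof.
move=> XY; split; apply/matrixP => i j; by have /matrixP /(_ i j) := XY;
  rewrite !mxE => -[]; rewrite !(mul0r, mulr0, mul1r, addr0, subr0, add0r).
Qed.

Lemma conjE (x : C) : Num.conj x = conjc x.
Proof. by []. Qed.

(** The sum of the adjoint and the transpose of F is twice its real part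
    transposed, so the two complex Gram matrices carry the same information as
    the three real ones; both being real forces the real and imaginary parts to
    be mutually orthogonal. *)
Lemma gram_real_parts m k (F : 'M[C]_(m, k)) (G P : 'M[R]_k) :
  F^t* *m F = rc G /\ F^T *m F = rc P <->
  (real_parts F)^T *m real_parts F =
    block_mx (2^-1 *: (G + P)) 0 0 (2^-1 *: (G - P)).
Proof.
rewrite [in X in X <-> _](real_partsE F).
set A := lsubmx _; set B := rsubmx _.
have -> : real_parts F = row_mx A B by rewrite hsubmxK.
have -> : (rc A + 'i *: rc B)^t* = rc A^T - 'i *: rc B^T.
  by apply/matrixP => i j; rewrite !mxE conjE; simpc.
have -> : (rc A + 'i *: rc B)^T = rc A^T + 'i *: rc B^T.
  by rewrite linearD linearZ /= !map_trmx.
have ii : 'i * 'i = -1 :> C by rewrite -expr2 sqr_i.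
have -> : (rc A^T - 'i *: rc B^T) *m (rc A + 'i *: rc B) =
    rc (A^T *m A + B^T *m B) + 'i *: rc (A^T *m B - B^T *m A).
  rewrite mulmxBl !mulmxDr -!scalemxAl -!scalemxAr scalerA ii -!map_mxM.
  by rewrite scaleN1r map_mxB map_mxD scalerBr opprD opprK [- _ + _]addrC addrACA.
have -> : (rc A^T + 'i *: rc B^T) *m (rc A + 'i *: rc B) =
    rc (A^T *m A - B^T *m B) + 'i *: rc (A^T *m B + B^T *m A).
  rewrite mulmxDl !mulmxDr -!scalemxAl -!scalemxAr scalerA ii -!map_mxM.
  by rewrite scaleN1r map_mxB map_mxD scalerDr [_ + - _]addrC addrACA.
rewrite tr_row_mx mul_col_row.
have rc0 X : rc X = rc X + 'i *: rc (0 : 'M[R]_k) by rewrite map_mx0 scaler0 addr0.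
split.
  rewrite [rc G]rc0 [rc P]rc0 => -[/rc_inj [e1 e2] /rc_inj [e3 e4]].
  have half (X Y : 'M[R]_k) : X + X = Y -> X = 2^-1 *: Y.
    by move=> <-; rewrite -mulr2n -(scaler_nat 2 X) scalerA mulVf ?scale1r // pnatr_eq0.
  congr block_mx.
  - by apply: half; rewrite -e1 -e3 addrACA subrr addr0.
  - by rewrite -[RHS](scaler0 _ (2^-1 : R)); apply: half; rewrite {2}(subr0_eq e2).
  - by rewrite -[RHS](scaler0 _ (2^-1 : R)); apply: half; rewrite -{1}(subr0_eq e2).
  - by apply: half; rewrite -e1 -e3 opprB [RHS]addrC addrA subrK.
move=> /eq_block_mx [e1 e2 e3 e4]; rewrite e1 e2 e3 e4 subr0 addr0 -!rc0.
by split; congr map_mx; apply/matrixP => i j; rewrite !mxE; field.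
Qed.

End RealParts.

(** * Frames in normal form *)
Section NormalForm.
Local Open Scope complex_scope.
Local Open Scope sesquilinear_scope.
Variable R : realType.
Local Notation C := R[i].
Local Notation rc := (map_mx (real_complex R)).
Implicit Types x z : R.

Definition unip x z : 'M[R]_4 :=
  mx4 [:: [:: 1; 0; x; 0]; [:: 0; 1; 0; 0]; [:: 0; 0; 1; 0]; [:: 0; z; 0; 1]].

Definition pivots x z : 'rV[R]_4 :=
  \row_i (2^-1 * [:: 1; 3 - 2 * x - z ^+ 2; 3 - 2 * z - x ^+ 2; 1]`_i).

(** The nonzero off-diagonal entries of the form of diag(x, z) pair the indices
    0, 2 and 1, 3, so one elimination step in each 2 x 2 block suffices. *)
Lemma half_gram x z :
  (unip x z)^T *m diag_mx (pivots x z) *m unip x z =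
  2^-1 *: (binom3 R + cubic_form (mx2 x 0 0 z)).
Proof.
rewrite mul_mx_diag; apply/matrixP => i j; rewrite !mxE.
rewrite !(big_ord_recl, big_ord0) !mxE.
by case: i => [[|[|[|[|//]]]] ?]; case: j => [[|[|[|[|//]]]] ?] /=;
  rewrite ?(mulr0n, mulr1n) /binomial /=; field.
Qed.

Lemma unipV x z : unip x z *m unip (- x) (- z) = 1%:M.
Proof.
apply/matrixP => i j; rewrite !mxE !(big_ord_recl, big_ord0) !mxE.
by case: i => [[|[|[|[|//]]]] ?]; case: j => [[|[|[|[|//]]]] ?] /=;
  rewrite ?(mulr0n, mulr1n) /=; ring.
Qed.

(** The imaginary parts are governed by minus the form, that is by the pivots
    at (-x, -z). *)
Lemma cubic_form_diagN x z : cubic_form (mx2 (- x) 0 0 (- z)) = - cubic_form (mx2 x 0 0 z).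
Proof.
apply/matrixP => i j; rewrite !mxE.
by case: i => [[|[|[|[|//]]]] ?]; case: j => [[|[|[|[|//]]]] ?] /=; ring.
Qed.

Lemma map_binom3 : rc (binom3 R) = binom3 C.
Proof.
by apply/matrixP => i j; rewrite !mxE rmorphMn /= rmorph_nat.
Qed.

Lemma map_cubic_form x z : rc (cubic_form (mx2 x 0 0 z)) = cubic_form (mx2 x%:C 0 0 z%:C).
Proof.
apply/matrixP => i j; rewrite !mxE.
by case: i => [[|[|[|[|//]]]] ?]; case: j => [[|[|[|[|//]]]] ?];
  rewrite /= ?(rmorphN, rmorphM, rmorph0, rmorph_nat).
Qed.

(** In orthonormal coordinates, where the i-th monomial is multiplied by the
    square root of the binomial coefficient, this says that the columns are
    orthonormal. *)
Definition isometric m (F : 'M[C]_(m, 4)) := F^t* *m F = binom3 C.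

(** The hermitian and the bilinear Gram matrices of a frame whose sphere lies in
    the quadric with Takagi invariants x and z. *)
Definition normal_frame m x z (F : 'M[C]_(m, 4)) :=
  isometric F /\ F^T *m F = cubic_form (mx2 x%:C 0 0 z%:C).

Definition unip8 x z : 'M[R]_(4 + 4) := block_mx (unip x z) 0 0 (unip (- x) (- z)).
Definition pivots8 x z : 'rV[R]_(4 + 4) := row_mx (pivots x z) (pivots (- x) (- z)).

Lemma unip8V x z : unip8 x z *m unip8 (- x) (- z) = 1%:M.
Proof.
by rewrite mulmx_block !unipV !(mulmx0, mul0mx, addr0, add0r) -scalar_mx_block.
Qed.

Lemma normal_frame_gram m x z (F : 'M[C]_(m, 4)) :
  normal_frame x z F <->
  (real_parts F)^T *m real_parts F =
    (unip8 x z)^T *m diag_mx (pivots8 x z) *m unip8 x z.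
Proof.
rewrite /normal_frame /isometric -map_binom3 -map_cubic_form gram_real_parts.
rewrite diag_mx_row tr_block_mx !mulmx_block !trmx0.
by rewrite !(mulmx0, mul0mx, addr0, add0r) !half_gram cubic_form_diagN.
Qed.

Lemma normal_frame_orthogonal m x z (F F' : 'M[C]_(m, 4)) :
  normal_frame x z F -> normal_frame x z F' ->
  exists2 A : 'M[R]_m, A^T *m A = 1%:M & F' = rc A *m F.
Proof.
move=> /normal_frame_gram FG /normal_frame_gram; rewrite -FG => /esym.
case/gram_orthogonal => A Ao FA; exists A => //.
by rewrite [LHS]real_partsE FA -real_parts_mul -real_partsE.
Qed.

Lemma normal_frame_exists m x z :
  (exists F : 'M[C]_(m, 4), normal_frame x z F) <->
  (forall j, 0 <= pivots8 x z 0 j) /\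
  (#|[pred j | pivots8 x z 0%R j != 0%R]| <= m)%N.
Proof.
split=> [[F /normal_frame_gram FG]|[p0 pm]].
  pose K := real_parts F *m unip8 (- x) (- z).
  have KK : K^T *m K = diag_mx (pivots8 x z).
    rewrite trmx_mul mulmxA -[_ *m _ *m real_parts F]mulmxA FG.
    rewrite !mulmxA -trmx_mul unip8V trmx1 mul1mx -mulmxA unip8V mulmx1 //.
  split=> [j|]; last exact: gram_diag_rank KK.
  have /matrixP /(_ j j) := KK; rewrite !mxE eqxx mulr1n => <-.
  by apply: sumr_ge0 => l _; rewrite mxE -expr2 sqr_ge0.
have [K KK] := gram_diag_exists p0 pm.
exists (let L := K *m unip8 x z in rc (lsubmx L) + 'i *: rc (rsubmx L)).
by apply/normal_frame_gram; rewrite real_partsK trmx_mul mulmxA -[_ *m _ *m K]mulmxA KK.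
Qed.

(** In the last condition, 6 counts the pivots that are positive on the whole
    domain. *)
Definition frame_domain m : set (R * R) := [set p | [/\ 0 <= p.2, p.2 <= p.1,
  p.2 ^+ 2 + 2 * p.1 <= 3 &
  (6 + ((p.1 ^+ 2 + 2 * p.2)%R != 3%R) + ((p.2 ^+ 2 + 2 * p.1)%R != 3%R) <= m)%N]].

Lemma pivots8_count x z :
  #|[pred j | pivots8 x z 0%R j != 0%R]| =
   (4 + ((z ^+ 2 + 2 * x)%R != 3%R) + ((x ^+ 2 + 2 * z)%R != 3%R)
      + ((z ^+ 2)%R != (3 + 2 * x)%R) + ((x ^+ 2)%R != (3 + 2 * z)%R))%N.
Proof.
rewrite -sum1_card big_mkcond big_split_ord /= !(big_ord_recl, big_ord0) /=.
rewrite !inE /pivots8 !(row_mxEl, row_mxEr) !mxE /=.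
have h (a b c : R) : a = b - c -> (2^-1 * a != 0) = (c != b).
  move=> ->; rewrite mulf_eq0 invr_eq0 pnatr_eq0 /= subr_eq0 eq_sym //.
rewrite mulr1 (h _ 3 (z ^+ 2 + 2 * x)); last by ring.
rewrite (h _ 3 (x ^+ 2 + 2 * z)); last by ring.
rewrite (h _ (3 + 2 * x) (z ^+ 2)); last by ring.
rewrite (h _ (3 + 2 * z) (x ^+ 2)); last by ring.
rewrite invr_eq0 pnatr_eq0 /=; do 4! case: (_ != _); by [].
Qed.

(** The key identity is
    (z^2 + 2x) - (x^2 + 2z) = (x - z) (2 - x - z), where x + z <= 2 on the
    domain: the pivot 3 - 2x - z^2 is the smallest of the
    four variable ones. *)
Lemma frame_domainP m x z : 0 <= z -> z <= x ->
  (exists F : 'M[C]_(m, 4), normal_frame x z F) <-> frame_domain m (x, z).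
Proof.
move=> z0 zx; rewrite normal_frame_exists pivots8_count.
have h : z ^+ 2 + 2 * x <= 3 ->
    [/\ x ^+ 2 + 2 * z <= 3, z ^+ 2 < 3 + 2 * x & x ^+ 2 < 3 + 2 * z].
  move=> zx3; have xz2 : x + z <= 2 by have := sqr_ge0 (z - 1); nra.
  have x32 : 2 * x <= 3 by have := sqr_ge0 z; lra.
  by split; nra.
split=> [[p0 pm]|[/= _ _ zx3 pm]].
  have zx3 : z ^+ 2 + 2 * x <= 3.
    have := p0 (lshift _ 1); rewrite row_mxEl mxE /=.
    rewrite pmulr_rge0 ?invr_gt0 //; lra.
  have [h1 h2 h3] := h zx3.
  split=> //=; apply: leq_trans pm.
  rewrite (lt_eqF h2) (lt_eqF h3) /=; do 2! case: (_ != _); by [].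
have [h1 h2 h3] := h zx3; split; last first.
  apply: leq_trans pm; rewrite (lt_eqF h2) (lt_eqF h3) /=; do 2! case: (_ != _); by [].
move=> j; rewrite -(fintype.splitK j); case: (fintype.split j) => i /=.
  by rewrite row_mxEl mxE; case: i => [[|[|[|[|//]]]] ?] /=; lra.
by rewrite row_mxEr mxE; case: i => [[|[|[|[|//]]]] ?] /=; lra.
Qed.

End NormalForm.

(** * Spheres in projective space *)
Section Spheres.
Local Open Scope complex_scope.
Local Open Scope sesquilinear_scope.
Variable R : realType.
Local Notation C := R[i].
Local Notation rc := (map_mx (real_complex R)).

Lemma pt_eqP n (z z' : 'cV[C]_n.+1) : z != 0 -> z' != 0 -> pt z = pt z' ->
  exists c, z' = c *: z.
Proof.
move=> z0 z'0 zz'; have : z' \in <[z]>%VS by rewrite -val_pt // zz' val_pt // memv_line.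
by case/vlineP=> c ->; exists c.
Qed.

Lemma unitmx_mul_neq0 n (M : 'M[C]_n) (z : 'cV[C]_n) :
  M \in unitmx -> z != 0 -> M *m z != 0.
Proof.
by move=> Mu; apply: contra => /eqP Mz; rewrite -[z](mulKmx Mu) Mz mulmx0.
Qed.

Lemma mxact_comp n (M N : 'M[C]_n.+1) : M \in unitmx -> N \in unitmx ->
  mxact M \o mxact N = mxact (M *m N).
Proof.
move=> Mu Nu; apply/funext => p /=; rewrite [RHS]/mxact -mulmxA.
have Np := unitmx_mul_neq0 Nu (coords_neq0 p).
by rewrite {2}/mxact (mxact_pt Np (unitmx_mul_neq0 Mu Np)).
Qed.

Lemma mxact1 n : mxact (1%:M : 'M[C]_n.+1) = id.
Proof. by apply/funext => p; rewrite /mxact mul1mx coordsK. Qed.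

Lemma mxactZ m n c (M : 'M[C]_(m.+1, n.+1)) : c != 0 ->
  (forall z : 'cV_n.+1, z != 0 -> M *m z != 0) -> mxact (c *: M) = mxact M.
Proof.
move=> c0 M0; apply/funext => p.
by rewrite /mxact -scalemxAl pt_scale // M0 // coords_neq0.
Qed.

Lemma is_O_unit n (A : 'M[R]_n) : is_O A -> rc A \in unitmx.
Proof. by move=> Ao; rewrite map_unitmx; case/mulmx1_unit: Ao. Qed.

Lemma sphere_equiv_sym n (f g : CP R 1 -> CP R n) :
  sphere_equiv f g -> sphere_equiv g f.
Proof.
move=> [A [U [Ao [Uu Ud] ->]]]; exists A^T, (U^t*).
have Ao' : A *m A^T = 1%:M by apply: mulmx1C.
have ATo : is_O A^T by rewrite /is_O trmxK.
split; first exact: ATo.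
  by split; [rewrite trmxC_unitary|rewrite det_map_mx det_tr Ud rmorph1].
have UU : U *m U^t* = 1%:M by apply/unitarymxP.
have [Uunit Utunit] := mulmx1_unit UU.
have UK : mxact U \o mxact (U^t*) = id by rewrite (mxact_comp Uunit Utunit) UU mxact1.
have AK : mxact (rc A^T) \o mxact (rc A) = id.
  by rewrite (mxact_comp (is_O_unit ATo) (is_O_unit Ao)) -map_mxM Ao map_mx1 mxact1.
apply/funext => p /=; rewrite -[mxact U _]/((mxact U \o mxact (U^t*)) p) UK /=.
by rewrite -[RHS]/((mxact (rc A^T) \o mxact (rc A)) (f p)) AK.
Qed.

Lemma sphere_equiv_trans n (f g h : CP R 1 -> CP R n) :
  sphere_equiv f g -> sphere_equiv g h -> sphere_equiv f h.
Proof.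
move=> [A [U [Ao [Uu Ud] ->]]] [B [V [Bo [Vu Vd] ->]]].
exists (B *m A), (U *m V); split.
- by rewrite /is_O trmx_mul mulmxA -[_ *m B]mulmxA Bo mulmx1.
- by split; [exact: mul_unitarymx|rewrite det_mulmx Ud Vd mulr1].
rewrite map_mxM -(mxact_comp (is_O_unit Bo) (is_O_unit Ao)).
by rewrite -(mxact_comp (unitarymx_unit Uu) (unitarymx_unit Vu)).
Qed.

Definition sphere n (F : 'M[C]_(n.+1, 4)) (p : CP R 1) : CP R n :=
  pt (F *m monomials (coords p)).

Lemma binom3_unit : binom3 C \in unitmx.
Proof.
rewrite unitmxE det_diag unitfE; apply/prodf_neq0 => i _.
by rewrite mxE pnatr_eq0 -lt0n bin_gt0 -ltnS.
Qed.

Lemma monomials_neq0 (w : 'cV[C]_2) : w != 0 -> monomials w != 0.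
Proof.
apply: contra => /eqP /colP mw; apply/eqP/colP; elim/ord2_ind; rewrite mxE.
  by have /eqP := mw 0; rewrite !mxE expr0 mulr1 expf_eq0 => /eqP.
by have /eqP := mw (inord 3); rewrite !mxE inordK // expr0 mul1r expf_eq0 => /eqP.
Qed.

Lemma isometric_monomials_neq0 m (F : 'M[C]_(m, 4)) w :
  isometric F -> w != 0 -> F *m monomials w != 0.
Proof.
move=> Fi w0; have := unitmx_mul_neq0 binom3_unit (monomials_neq0 w0).
by rewrite -Fi -mulmxA; apply: contra => /eqP ->; rewrite mulmx0.
Qed.

Lemma sphere_pt n (F : 'M[C]_(n.+1, 4)) w : isometric F -> w != 0 ->
  sphere F (pt w) = pt (F *m monomials w).
Proof.
move=> Fi w0; have [c c0 cE] := coords_pt w0.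
by rewrite /sphere cE monomialsZ -scalemxAr pt_scale ?expf_neq0 ?isometric_monomials_neq0.
Qed.

Lemma sphere_scale n c (F : 'M[C]_(n.+1, 4)) : isometric F -> c != 0 ->
  sphere (c *: F) = sphere F.
Proof.
move=> Fi c0; apply/funext => p.
by rewrite /sphere -scalemxAl pt_scale ?isometric_monomials_neq0 ?coords_neq0.
Qed.

Lemma sphere_reparam n (F : 'M[C]_(n.+1, 4)) (U : 'M[C]_2) : isometric F -> U \in unitmx ->
  sphere F \o mxact U = sphere (F *m sym3 U).
Proof.
move=> Fi Uu; apply/funext => p /=.
have Up := unitmx_mul_neq0 Uu (coords_neq0 p).
by rewrite /mxact (sphere_pt Fi Up) monomials_mul mulmxA.
Qed.

Lemma sphere_orthogonal n (F : 'M[C]_(n.+1, 4)) (A : 'M[R]_n.+1) : isometric F -> is_O A ->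
  mxact (rc A) \o sphere F = sphere (rc A *m F).
Proof.
move=> Fi Ao; apply/funext => p /=.
have Fp := isometric_monomials_neq0 Fi (coords_neq0 p).
have Ap := unitmx_mul_neq0 (is_O_unit Ao) Fp.
by rewrite /sphere -mulmxA (mxact_pt Fp Ap).
Qed.

Lemma isometric_sym3 m (F : 'M[C]_(m, 4)) (U : 'M[C]_2) : isometric F -> U \is unitarymx ->
  isometric (F *m sym3 U).
Proof.
move=> Fi Uu; rewrite /isometric trmx_mul map_mxM mulmxA -[_ *m F]mulmxA.
by rewrite [F^t* *m F]Fi sym3_unitary.
Qed.

Lemma isometric_orthogonal m (F : 'M[C]_(m, 4)) (A : 'M[R]_m) : isometric F -> is_O A ->
  isometric (rc A *m F).
Proof.
move=> Fi Ao; rewrite /isometric trmx_mul map_mxM mulmxA -[_ *m rc A]mulmxA.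
have -> : (rc A)^t* = rc A^T.
  by apply/matrixP => i j; rewrite !mxE conjE conjc_real.
by rewrite -map_mxM Ao map_mx1 mulmx1.
Qed.

Lemma trmxCZ m k (F : 'M[C]_(m, k)) c : (c *: F)^t* = c^* *: F^t*.
Proof. by apply/matrixP => i j; rewrite !mxE rmorphM. Qed.

Lemma isometricZ m (F : 'M[C]_(m, 4)) c : isometric F -> c * c^* = 1 ->
  isometric (c *: F).
Proof.
move=> Fi cc; rewrite /isometric trmxCZ -scalemxAl -scalemxAr scalerA.
by rewrite mulrC cc scale1r.
Qed.

(** The scalar lambda(t) with F' m(1, t) = lambda(t) F m(1, t) is a cubic
    polynomial p0, read off from the first coordinate of the adjoint of F
    applied to both sides; the last coordinate shows that p0 X^3 also has
    degree at most 3, so lambda is constant. *)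
Lemma sphere_inj n (F F' : 'M[C]_(n.+1, 4)) : isometric F -> isometric F' ->
  sphere F = sphere F' -> exists2 c, c * c^* = 1 & F' = c *: F.
Proof.
move=> Fi F'i FF'.
have w0 t : vec2 1 t != 0 :> 'cV[C]_2.
  by apply/eqP => /colP /(_ 0) /eqP; rewrite !mxE oner_eq0.
have lam t : exists c, F' *m monomials (vec2 1 t) = c *: (F *m monomials (vec2 1 t)).
  apply: (pt_eqP (isometric_monomials_neq0 Fi (w0 t)) (isometric_monomials_neq0 F'i (w0 t))).
  by rewrite -(sphere_pt Fi (w0 t)) -(sphere_pt F'i (w0 t)) FF'.
pose N := F^t* *m F'.
have NE t c : F' *m monomials (vec2 1 t) = c *: (F *m monomials (vec2 1 t)) ->
   N *m monomials (vec2 1 t) = c *: (binom3 C *m monomials (vec2 1 t)).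
  by move=> e; rewrite -mulmxA e -scalemxAr mulmxA [F^t* *m F]Fi.
pose p (i : 'I_4) := \poly_(j < 4) N i (inord j).
have pE i t : (p i).[t] = (N *m monomials (vec2 1 t)) i 0.
  rewrite horner_poly mxE; apply: eq_bigr => j _.
  by rewrite !mxE /= expr1n mul1r inord_val.
have lE t c : F' *m monomials (vec2 1 t) = c *: (F *m monomials (vec2 1 t)) -> c = (p 0).[t].
  move=> /NE e; rewrite pE e /binom3 mul_diag_mx !mxE /= expr1n expr0 bin0; ring.
have p3 : p 0 * 'X^3 = p ord_max.
  apply/eqP; rewrite -subr_eq0; apply/eqP/poly_eq0_horner => t.
  have [c cE] := lam t; rewrite !hornerE -(lE _ _ cE) pE (NE _ _ cE).
  by rewrite /binom3 mul_diag_mx !mxE /= expr0 binn; ring.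
have p0 : p 0 = ((p 0)`_0)%:P.
  apply/polyP => k; rewrite coefC; case: k => [//|k].
  have /(congr1 (fun q : {poly C} => q`_(k.+1 + 3))) := p3.
  by rewrite coefMXn addnK !coef_poly addnC.
pose c := (p 0)`_0.
have F'E : F' = c *: F.
  apply: monomials_sep => t; have [d dE] := lam t.
  by rewrite dE (lE _ _ dE) p0 hornerC scalemxAl.
exists c => //; have := F'i; rewrite F'E /isometric trmxCZ.
rewrite -scalemxAl -scalemxAr scalerA [F^t* *m F]Fi => /matrixP /(_ 0 0).
by rewrite !mxE mulr1n bin0 mulr1 mulrC.
Qed.

End Spheres.

(** * Every sphere has a unique normal form *)
Section Classification.
Local Open Scope complex_scope.
Local Open Scope sesquilinear_scope.
Variable R : realType.
Local Notation C := R[i].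
Local Notation rc := (map_mx (real_complex R)).

Definition sqrt_binom : 'rV[C]_4 := \row_i (Num.sqrt ('C(3, i)%:R : R))%:C.

Lemma veronese_monomials (w : 'cV[C]_2) : veronese 3 w = diag_mx sqrt_binom *m monomials w.
Proof. by rewrite mul_diag_mx; apply/colP => i; rewrite !mxE mulrA. Qed.

(** The normalizing square roots of the rational normal curve are exactly what
    turns orthonormal columns into columns of square norms 1, 3, 3, 1. *)
Lemma sqrt_binomK : (diag_mx sqrt_binom)^t* *m diag_mx sqrt_binom = binom3 C.
Proof.
have -> : (diag_mx sqrt_binom)^t* = diag_mx sqrt_binom.
  apply/matrixP => i j; rewrite !mxE eq_sym rmorphMn /= conjE conjc_real.
  by case: eqVneq => [->|]; rewrite ?mulr0n.
rewrite mul_diag_mx; apply/matrixP => i j; rewrite !mxE mulrnAr -rmorphM /=.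
by rewrite -expr2 sqr_sqrtr ?ler0n // rmorph_nat.
Qed.

Lemma sqrt_binom_unit : diag_mx sqrt_binom \in unitmx.
Proof. by have := binom3_unit R; rewrite -sqrt_binomK unitmx_mul => /andP[]. Qed.

Lemma veronese_sphere n (E : 'M[C]_(n.+1, 4)) : E^t* *m E = 1%:M ->
  mxact E \o @rnc R 3 = sphere (E *m diag_mx sqrt_binom).
Proof.
move=> EE; apply/funext => p /=.
have v0 := veronese_neq0 3 (coords_neq0 p).
have Ev0 : E *m veronese 3 (coords p) != 0.
  by apply: contra v0 => /eqP Ev; rewrite -[veronese _ _]mul1mx -EE -mulmxA Ev mulmx0.
by rewrite /rnc (mxact_pt v0 Ev0) /sphere -mulmxA -veronese_monomials.
Qed.

Lemma sum_sqr m (z : 'cV[C]_m) : \sum_i z i 0 ^+ 2 = (z^T *m z) 0 0.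
Proof. by rewrite mxE; apply: eq_bigr => i _; rewrite mxE expr2. Qed.

(** The matrix of orthonormal columns and the frame F differ by the square roots
    of the binomial coefficients, and the quadric condition along the points
    (1, t) is the hypothesis of [cubic_formP]; the converse is [cubic_formE] on
    the diagonal. *)
Lemma H_sphereP n (f : CP R 1 -> CP R n) : H R 3 n f <->
  exists F : 'M[C]_(n.+1, 4), [/\ isometric F,
    exists2 S : 'M[C]_2, S^T = S & F^T *m F = cubic_form S & f = sphere F].
Proof.
split=> [[[E EE ->] fQ]|[F [Fi [S SE FF] ->]]].
  have Fi : isometric (E *m diag_mx sqrt_binom).
    rewrite /isometric trmx_mul map_mxM mulmxA -[_ *m E]mulmxA EE mulmx1.
    exact: sqrt_binomK.
  move: (veronese_sphere EE) fQ Fi => ->; move: (E *m _) => F fQ Fi.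
  exists F; split=> //.
  apply: cubic_formP => [|t]; first by rewrite trmx_mul trmxK.
  have w0 : vec2 1 t != 0 :> 'cV[C]_2.
    by apply/eqP => /colP /(_ 0) /eqP; rewrite !mxE oner_eq0.
  have := fQ _ (ex_intro2 _ _ (pt (vec2 1 t)) I erefl).
  rewrite sphere_pt // => -[z [z0 zQ]].
  case/(pt_eqP z0 (isometric_monomials_neq0 Fi w0)) => c cE.
  rewrite mulmxA -trmx_mul -mulmxA cE [(_ *: _)^T]linearZ /= -scalemxAl -scalemxAr.
  rewrite [z^T *m z]mx11_scalar -sum_sqr zQ; apply/matrixP => i j.
  by rewrite !mxE mul0rn !mulr0.
split; last first.
  move=> _ [p _ <-]; rewrite /sphere; exists (F *m monomials (coords p)) => //=.
  split; first exact: isometric_monomials_neq0 (coords_neq0 p).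
  rewrite sum_sqr trmx_mul mulmxA -[_ *m F]mulmxA FF cubic_formE //.
  by rewrite mulrC subrr expr0n scale0r mxE.
have EE : (F *m invmx (diag_mx sqrt_binom))^t* *m (F *m invmx (diag_mx sqrt_binom)) = 1%:M.
  rewrite trmx_mul map_mxM mulmxA -[_ *m F]mulmxA [F^t* *m F]Fi -sqrt_binomK.
  rewrite -mulmxA mulmxK ?sqrt_binom_unit // -map_mxM -trmx_mul mulmxV ?sqrt_binom_unit //.
  by rewrite trmx1 map_mx1.
exists (F *m invmx (diag_mx sqrt_binom)) => //.
by rewrite veronese_sphere // mulmxKV ?sqrt_binom_unit.
Qed.

Lemma normal_frame_H n x z (F : 'M[C]_(n.+1, 4)) : normal_frame x z F -> H R 3 n (sphere F).
Proof.
move=> [Fi FF]; apply/H_sphereP; exists F; split=> //; exists (mx2 x%:C 0 0 z%:C) => //.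
by apply/matrixP; do 2! elim/ord2_ind; rewrite !mxE.
Qed.

Lemma cubic_formZ (c : C) S : cubic_form (c *: S) = c *: cubic_form S.
Proof.
apply/matrixP => i j; rewrite !mxE.
by case: i => [[|[|[|[|//]]]] ?]; case: j => [[|[|[|[|//]]]] ?];
  rewrite /= ?mulr0 ?mulrN //; congr (- _); rewrite mulrCA.
Qed.

Lemma frame_reparam m (F : 'M[C]_(m, 4)) U S : S^T = S -> F^T *m F = cubic_form S ->
  (F *m sym3 U)^T *m (F *m sym3 U) = \det U ^+ 2 *: cubic_form (U^T *m S *m U).
Proof.
move=> SE FF; rewrite trmx_mul mulmxA -[_ *m F]mulmxA FF; exact: cubic_form_sym3.
Qed.

Lemma unitary_det (U : 'M[C]_2) : U \is unitarymx -> \det U * (\det U)^* = 1.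
Proof.
by move=> /unitarymxP /(congr1 determinant); rewrite det_mulmx det_map_mx det_tr det1.
Qed.

Lemma unitaryZ (U : 'M[C]_2) c : U \is unitarymx -> c * c^* = 1 -> c *: U \is unitarymx.
Proof.
move=> /unitarymxP UU cc; apply/unitarymxP.
by rewrite trmxCZ -scalemxAl -scalemxAr scalerA UU cc scale1r.
Qed.

Lemma unit_complex_neq0 (c : C) : c * c^* = 1 -> c != 0.
Proof. by apply: contra_eq_neq => ->; rewrite mul0r eq_sym oner_eq0. Qed.

(** Dividing by a square root of the determinant, of modulus 1, does not change
    the projective transformation. *)
Lemma unitary_SU2 (V : 'M[C]_2) : V \is unitarymx ->
  exists2 U, is_SU2 U & mxact U = mxact V.
Proof.
move=> Vu; have dV := unitary_det Vu; pose m := sqrtC (\det V).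
have mm : m * m^* = 1.
  rewrite -normCK -normrX sqrtCK; apply/eqP.
  by rewrite -sqrp_eq1 ?normr_ge0 // normCK dV.
have m0 := unit_complex_neq0 mm.
have mV : m^-1 = m^* by apply: (mulfI m0); rewrite mm mulfV.
exists (m^-1 *: V).
  split; first by apply: unitaryZ; rewrite // mV conjCK mulrC.
  by rewrite detZ exprVn sqrtCK mulVf // unit_complex_neq0.
apply: mxactZ; first by rewrite invr_eq0.
by move=> z; apply: unitmx_mul_neq0; apply: unitarymx_unit.
Qed.

(** After reparametrization by the Takagi basis V of S, the form of the frame is
    det(V)^2 times that of diag(x, z); the factor is absorbed by the phase
    det(V)^-1. *)
Lemma H_normal_frame n (f : CP R 1 -> CP R n) : H R 3 n f ->
  exists x z (F : 'M[C]_(n.+1, 4)),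
    [/\ frame_domain n.+1 (x, z), normal_frame x z F & sphere_equiv (sphere F) f].
Proof.
case/H_sphereP => F0 [F0i [S SE FS] ->].
have [V Vu [x [z [z0 zx VS]]]] := takagi SE.
have xR : (complex.Re x)%:C = x by apply: RRe_real; apply: ger0_real; apply: le_trans zx.
have zR : (complex.Re z)%:C = z by apply: RRe_real; apply: ger0_real.
have dV := unitary_det Vu; have d0 := unit_complex_neq0 dV.
pose F := (\det V)^-1 *: (F0 *m sym3 V).
have F1i := isometric_sym3 F0i Vu.
have dVV : (\det V)^-1 * ((\det V)^-1)^* = 1.
  have -> : (\det V)^-1 = (\det V)^* by apply: (mulfI d0); rewrite dV mulfV.
  by rewrite conjCK mulrC.
have FN : normal_frame (complex.Re x) (complex.Re z) F.
  split; first exact: isometricZ.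
  rewrite /F [(_ *: _)^T]linearZ /= -scalemxAl -scalemxAr scalerA.
  rewrite (frame_reparam _ SE FS) VS xR zR scalerA.
  by rewrite -expr2 exprVn mulVf ?scale1r // expf_neq0.
exists (complex.Re x), (complex.Re z), F; split => //.
  apply/frame_domainP; last by exists F.
    by rewrite -lecR zR.
  by rewrite -lecR zR xR.
have [U [Uu Ud] UV] := unitary_SU2 Vu.
apply: sphere_equiv_sym; exists 1%:M, U; split=> //.
  by rewrite /is_O trmx1 mulmx1.
rewrite map_mx1 mxact1 UV.
have dV0 : (\det V)^-1 != 0 by rewrite invr_eq0.
apply: etrans (sphere_scale F1i dV0) _.
exact: esym (sphere_reparam F0i (unitarymx_unit Vu)).
Qed.

Lemma normal_frame_equiv n x z (F F' : 'M[C]_(n.+1, 4)) :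
  normal_frame x z F -> normal_frame x z F' -> sphere_equiv (sphere F) (sphere F').
Proof.
move=> FN F'N; have [A Ao ->] := normal_frame_orthogonal FN F'N.
exists A, 1%:M; split=> //.
  by split; rewrite ?det1 //; apply/unitarymxP; rewrite trmx1 map_mx1 mulmx1.
by rewrite mxact1 -sphere_orthogonal //; case: FN.
Qed.

Lemma cubic_form_inj (S S' : 'M[C]_2) : S^T = S -> S'^T = S' ->
  cubic_form S = cubic_form S' -> S = S'.
Proof.
move=> SE S'E /matrixP e.
have sC (M : 'M[C]_2) : M^T = M -> M 1 0 = M 0 1 by move=> ME; rewrite -[in LHS]ME mxE.
have e02 := e 0 (inord 2); have e03 := e 0 (inord 3); have e13 := e (inord 1) (inord 3).
move: e02 e03 e13; rewrite !mxE !inordK //= => e02 e03 e13.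
by apply/matrixP; do 2! elim/ord2_ind; rewrite // ?sC // ?e03.
Qed.

(** Equivalent frames have S' = c^2 U^T S U with c of modulus 1 and U in SU(2),
    so the modulus of the determinant, x z, and the Hilbert-Schmidt norm,
    x^2 + z^2, agree; together with the ordering they determine x and z. *)
Lemma normal_frame_uniq n x z x' z' (F F' : 'M[C]_(n.+1, 4)) :
  0 <= z -> z <= x -> 0 <= z' -> z' <= x' ->
  normal_frame x z F -> normal_frame x' z' F' ->
  sphere_equiv (sphere F) (sphere F') -> (x, z) = (x', z').
Proof.
move=> z0 zx z'0 z'x [Fi FF] [F'i FF'] [A [U [Ao [Uu Ud]]]].
rewrite (sphere_orthogonal Fi Ao) => e.
have x0 := le_trans z0 zx; have x'0 := le_trans z'0 z'x.
have AFi := isometric_orthogonal Fi Ao.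
have e' := etrans (esym (sphere_reparam AFi (unitarymx_unit Uu))) (esym e).
have [c cc F'E] := sphere_inj (isometric_sym3 AFi Uu) F'i e'.
clear e e'.
set S := mx2 x%:C 0 0 z%:C in FF; set S' := mx2 x'%:C 0 0 z'%:C in FF'.
have SE : S^T = S by apply/matrixP; do 2! elim/ord2_ind; rewrite !mxE.
have S'E : S'^T = S' by apply/matrixP; do 2! elim/ord2_ind; rewrite !mxE.
have e : S' = c ^+ 2 *: (U^T *m S *m U).
  apply: cubic_form_inj => //; first by rewrite linearZ /= !trmx_mul trmxK SE mulmxA.
  rewrite cubic_formZ -FF' F'E [(_ *: _)^T]linearZ /= -scalemxAl -scalemxAr scalerA -expr2.
  rewrite (@frame_reparam _ _ U S) // ?Ud ?expr1n ?scale1r //.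
  rewrite trmx_mul mulmxA -[_ *m rc A]mulmxA map_trmx -map_mxM Ao map_mx1 mulmx1 //.
have cn : `|c| = 1 by apply/eqP; rewrite -sqrp_eq1 ?normr_ge0 // normCK cc.
have detS (a b : R) : \det (mx2 a%:C 0 0 b%:C) = (a * b)%:C.
  by rewrite det2 !mxE mul0r subr0 /= rmorphM.
have xz : x * z = x' * z'.
  have := congr1 determinant e; rewrite detZ !det_mulmx det_tr Ud mul1r mulr1 !detS.
  move=> /(congr1 Num.norm); rewrite normrM !normrX cn !expr1n mul1r.
  by rewrite !ger0_norm ?ler0c ?mulr_ge0 // => /complexI.
have xxzz : x ^+ 2 + z ^+ 2 = x' ^+ 2 + z' ^+ 2.
  have trS (a b : R) :
      \tr ((mx2 a%:C 0 0 b%:C)^t* *m mx2 a%:C 0 0 b%:C) = (a ^+ 2 + b ^+ 2)%:C.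
    rewrite /mxtrace big_ord2 !mxE !big_ord2 !mxE /= !conjE !conjc_real.
    by rewrite rmorph0 !mulr0 addr0 add0r rmorphD !rmorphXn.
  apply: complexI; rewrite -!trS -/S -/S' e trmxCZ -scalemxAl -scalemxAr scalerA mxtraceZ.
  have -> : (c ^+ 2)^* * c ^+ 2 = 1 by rewrite rmorphXn -exprMn mulrC cc expr1n.
  rewrite mul1r !trmx_mul !map_mxM trmxK -!mulmxA [RHS]mxtrace_mulC -!mulmxA.
  have UcU : map_mx Num.conj U *m U^T = 1%:M.
    by apply: trmx_inj; rewrite trmx_mul trmxK trmx1 map_trmx; apply/unitarymxP.
  have UU : U *m U^t* = 1%:M by apply/unitarymxP.
  by rewrite UU mulmx1 [map_mx _ U *m _]mulmxA UcU mul1mx.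
have h (a b : R) : 0 <= a -> 0 <= b -> a ^+ 2 = b ^+ 2 -> a = b.
  by move=> a0 b0 ab; apply/eqP; rewrite -(@eqrXn2 _ 2) // ab.
have : x + z = x' + z' by apply: h; nra.
have : x - z = x' - z' by apply: h; nra.
by move=> ??; congr pair; lra.
Qed.

(** A pair in the domain is sent to the class of its normal frames, well defined
    by [normal_frame_equiv], injective by [normal_frame_uniq] and surjective by
    [H_normal_frame]. *)
Lemma moduli_bij n : exists psi : R * R -> set (CP R 1 -> CP R n),
  set_bij (frame_domain n.+1) (moduli R 3 n) psi.
Proof.
pose psi (p : R * R) := [set g | H R 3 n g /\
  exists2 F, normal_frame p.1 p.2 F & sphere_equiv (sphere F) g].
have psiE p F : normal_frame p.1 p.2 F ->
    psi p = [set g | H R 3 n g /\ sphere_equiv (sphere F) g].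
  move=> FN; apply/seteqP; split=> g [Hg].
    case=> F' F'N F'g; split; first exact: Hg.
    exact: sphere_equiv_trans (normal_frame_equiv FN F'N) F'g.
  by move=> Fg; split; [exact: Hg|exists F].
have ex p : frame_domain n.+1 p -> exists F : 'M[C]_(n.+1, 4), normal_frame p.1 p.2 F.
  by case: p => x z D; apply/frame_domainP => //; case: D.
exists psi; split.
- move=> p /ex [F FN]; exists (sphere F); first exact: normal_frame_H FN.
  by rewrite (psiE _ _ FN).
- move=> p q; rewrite !inE => Dp Dq pq.
  have [F FN] := ex _ Dp; have [F' F'N] := ex _ Dq.
  have : psi q (sphere F').
    split; first exact: normal_frame_H F'N.
    by exists F'; [exact: F'N|exact: (normal_frame_equiv F'N F'N)].
  rewrite -pq (psiE _ _ FN) => -[_ FF'].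
  case: p q Dp Dq FN F'N {pq ex psiE} =>
    x z [x' z'] [/= z0 zx _ _] [/= z'0 z'x' _ _] /= FN F'N.
  exact: (normal_frame_uniq z0 zx z'0 z'x' FN F'N FF').
- move=> X [f Hf <-]; have [x [z [F [D FN Ff]]]] := H_normal_frame Hf.
  exists (x, z); first exact: D.
  rewrite (psiE (x, z) F FN); apply/seteqP; split=> g [Hg Fg].
    split; first exact: Hg.
    exact: sphere_equiv_trans (sphere_equiv_sym Ff) Fg.
  split; first exact: Hg.
  exact: sphere_equiv_trans Ff Fg.
Qed.

End Classification.

(** * The quarter circle and the quarter disk *)
Section Shapes.
Variable R : realType.

(** Boundary points are starting points of paths that lie in A afterwards. *)
Lemma closure_path (A : set (R * R)) (g : R -> R * R) :
  g @ (0 : R) --> g 0 -> (forall t, 0 < t -> t < 1 -> A (g t)) -> closure A (g 0).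
Proof.
move=> gc gA B /gc /nbhs_ballP [e /= e0 eB].
pose t := Num.min (e / 2) 2^-1.
have t0 : 0 < t by rewrite lt_min; apply/andP; split; lra.
have t2 : t <= 2^-1 by rewrite ge_min lexx orbT.
have te : t <= e / 2 by rewrite ge_min lexx.
exists (g t); split; first by apply: gA; lra.
by apply: eB; rewrite /ball /= sub0r normrN gtr0_norm //; lra.
Qed.

(** The point (1/2, 1/2) is interior to the quarter disk, so moving both
    coordinates towards it enters the open disk at once. *)
Definition pull_to_half (b t : R) : R := (1 - t) * b + t * 2^-1.

Lemma pull_to_half_cvg b : pull_to_half b @ (0 : R) --> pull_to_half b 0.
Proof.
apply: cvgD; apply: cvgM; [apply: cvgB| | |]; by [exact: cvg_cst|exact: cvg_id].
Qed.

Lemma pull_to_half0 b : pull_to_half b 0 = b.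
Proof. by rewrite /pull_to_half subr0 mul1r mul0r addr0. Qed.

Lemma pull_to_half_gt0 b t : 0 <= b -> 0 < t -> t < 1 -> 0 < pull_to_half b t.
Proof. by rewrite /pull_to_half => b0 t0 t1; nra. Qed.

Lemma closed_closure_sub (A B : set (R * R)) : A `<=` B -> closed B -> closure A `<=` B.
Proof. by move=> AB /closure_id ->; apply: closure_subset. Qed.

Definition closed_quarter_disk : set (R * R) :=
  [set p | [/\ 0 <= p.1, 0 <= p.2 & p.1 ^+ 2 + p.2 ^+ 2 <= 1]].

Definition closed_quarter_circle : set (R * R) :=
  [set p | [/\ 0 <= p.1, 0 <= p.2 & p.1 ^+ 2 + p.2 ^+ 2 = 1]].

Lemma continuous_sqnorm : continuous (fun p : R * R => p.1 ^+ 2 + p.2 ^+ 2).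
Proof.
move=> p; apply: cvgD; apply: (@cvg_comp _ _ _ _ (fun x : R => x ^+ 2));
  [exact: cvg_fst|exact: exprn_continuous|exact: cvg_snd|exact: exprn_continuous].
Qed.

Lemma closed_quadrant_level (D : set R) : closed D ->
  closed [set p : R * R | [/\ 0 <= p.1, 0 <= p.2 & D (p.1 ^+ 2 + p.2 ^+ 2)]].
Proof.
move=> Dc.
rewrite (_ : mkset _ = (fst @^-1` [set x | 0 <= x] `&` snd @^-1` [set x | 0 <= x])
   `&` ((fun p : R * R => p.1 ^+ 2 + p.2 ^+ 2) @^-1` D)); last first.
  by apply/seteqP; split=> p /=; [move=> []|move=> [[]]].
apply: closedI; first apply: closedI.
- by apply: preimage_closed; [move=> p _; exact: cvg_fst|exact: closed_ge].
- by apply: preimage_closed; [move=> p _; exact: cvg_snd|exact: closed_ge].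
- by apply: preimage_closed => // p _; exact: continuous_sqnorm.
Qed.

Lemma closure_quarter_disk : closure (quarter_disk R) = closed_quarter_disk.
Proof.
apply/seteqP; split.
  apply: closed_closure_sub; first by move=> p [/ltW ? /ltW ? /ltW ?].
  exact: (closed_quadrant_level (@closed_le _ 1)).
move=> [a b] [/= a0 b0 ab].
rewrite -[a]pull_to_half0 -[b]pull_to_half0.
apply: (@closure_path _ (fun t => (pull_to_half a t, pull_to_half b t))).
  exact: (cvg_pair (@pull_to_half_cvg a) (@pull_to_half_cvg b)).
move=> t t0 t1; split => /=; [exact: pull_to_half_gt0|exact: pull_to_half_gt0|].
(* Convexity of the square. *)
have conv c : pull_to_half c t ^+ 2 <= (1 - t) * c ^+ 2 + t * 2^-1 ^+ 2.
  have : 0 <= t * (1 - t) * (c - 2^-1) ^+ 2.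
    by rewrite mulr_ge0 ?sqr_ge0 // mulr_ge0 ?subr_ge0 // ltW.
  by rewrite /pull_to_half; nra.
have := conv a; have := conv b; nra.
Qed.

Lemma closure_quarter_circle : closure (quarter_circle R) = closed_quarter_circle.
Proof.
apply/seteqP; split.
  apply: closed_closure_sub; first by move=> p [/ltW ? /ltW ? ?].
  exact: (closed_quadrant_level (@closed_eq _ 1)).
move=> [a b] [/= a0 b0 ab].
pose g (t : R) := (Num.sqrt (1 - pull_to_half b t ^+ 2), pull_to_half b t).
have b1 : b <= 1 by have := sqr_ge0 a; nra.
have -> : (a, b) = g 0.
  rewrite /g pull_to_half0; congr pair.
  by rewrite -ab addrK sqrtr_sqr ger0_norm.
have sc : (fun t => Num.sqrt (1 - pull_to_half b t ^+ 2)) @ (0 : R) -->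
    Num.sqrt (1 - pull_to_half b 0 ^+ 2).
  apply: continuous_cvg; first exact: sqrt_continuous.
  apply: cvgB; first exact: cvg_cst.
  exact: (cvgM (@pull_to_half_cvg b) (@pull_to_half_cvg b)).
apply: closure_path; first exact: (cvg_pair sc (@pull_to_half_cvg b)).
move=> t t0 t1.
have y0 : 0 < pull_to_half b t by exact: pull_to_half_gt0.
have y1 : pull_to_half b t < 1 by rewrite /pull_to_half; nra.
have y2 : 0 < 1 - pull_to_half b t ^+ 2 by nra.
split=> //=; first by rewrite sqrtr_gt0.
by rewrite sqr_sqrtr ?subrK // ltW.
Qed.

(** At height z the region z <= x, z^2 + 2x <= 3 is a segment in x, and at
    height b the quarter disk is a segment in a^2 bounded by 1 - b^2.  This is
    the affine bijection between the two, written so that it stays defined at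
    the vertex b = 1 where both segments shrink to a point. *)
Definition straighten (p : R * R) : R * R :=
  (p.2 + p.1 ^+ 2 * ((3 + p.2) / (2 * (1 + p.2))), p.2).

Lemma straighten_bij (A : set (R * R)) (D : set (R * R)) :
  (forall p, A p -> 0 <= p.1 /\ 0 <= p.2) ->
  (forall q, D q -> 0 <= q.2 <= q.1) ->
  (forall p, 0 <= p.1 -> 0 <= p.2 -> A p <-> D (straighten p)) ->
  set_bij A D straighten.
Proof.
move=> A0 D0 AD.
have k0 b : 0 <= b -> 0 < (3 + b) / (2 * (1 + b)) :> R.
  by move=> b0; apply: divr_gt0; lra.
split.
- by move=> p Ap; have [p1 p2] := A0 _ Ap; apply/AD.
- move=> [a b] [a' b']; rewrite !inE => /A0 [/= a0 b0] /A0 [/= a'0 b'0].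
  move=> [e eb]; rewrite -eb in e *; congr pair.
  move/addrI: e => /(mulIf (lt0r_neq0 (k0 _ b0))) /eqP.
  by rewrite eqrXn2 // => /eqP.
- move=> [x z] Dq; have /= /andP[z0 zx] := D0 _ Dq.
  pose a := Num.sqrt ((x - z) / ((3 + z) / (2 * (1 + z)))).
  have E : straighten (a, z) = (x, z).
    rewrite /straighten /= sqr_sqrtr ?divfK ?lt0r_neq0 ?k0 //; first by rewrite addrC subrK.
    by rewrite divr_ge0 ?subr_ge0 // ltW // k0.
  by exists (a, z) => //; apply/AD; rewrite ?sqrtr_ge0 // E.
Qed.

Lemma frame_domain8 : frame_domain 8 =
  [set p : R * R | [/\ 0 <= p.2, p.2 <= p.1 & p.2 ^+ 2 + 2 * p.1 <= 3]].
Proof.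
apply/seteqP; split=> p [] // a b c; split=> //.
by do 2! case: (_ != _).
Qed.

(** If the pivot 3 - 2x - z^2 does not vanish, neither does the larger pivot
    3 - 2z - x^2, and eight dimensions are needed. *)
Lemma frame_domain7 : frame_domain 7 =
  [set p : R * R | [/\ 0 <= p.2, p.2 <= p.1 & p.2 ^+ 2 + 2 * p.1 = 3]].
Proof.
apply/seteqP; split=> -[x z] [/= z0 zx zx3].
  have [zx3'|zxN] := eqVneq (z ^+ 2 + 2 * x) 3; first by split.
  have [xz3 _|//] := eqVneq (x ^+ 2 + 2 * z) 3.
  have xz2 : x + z <= 2 by have := sqr_ge0 (z - 1); nra.
  case/eqP: zxN; nra.
by split; rewrite /= ?zx3 ?eqxx //; case: (_ != _).
Qed.

Lemma frame_domain6 : frame_domain 6 = [set (1, 1) : R * R].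
Proof.
apply/seteqP; split=> [[x z] [/= z0 zx zx3]|_ ->]; last first.
  have e : 1 ^+ 2 + 2 * 1 = 3 :> R by ring.
  by split; rewrite /= ?e ?eqxx ?lexx ?ler01.
have [zx3'|_] := eqVneq (z ^+ 2 + 2 * x) 3; last by case: (_ != _).
have [xz3' _|//] := eqVneq (x ^+ 2 + 2 * z) 3.
have : (x - z) * (x + z - 2) = 0 by nra.
have z1 : (z - 1) * (z + 3) = 0 -> z = 1.
  move=> /eqP; rewrite mulf_eq0 => /orP[/eqP|/eqP] ?; lra.
move=> /eqP; rewrite mulf_eq0 => /orP[/eqP xz|/eqP xz].
  have {}z1 : z = 1 by apply: z1; nra.
  by congr pair => //; lra.
have {}z1 : z = 1.
  have /eqP : (z - 1) ^+ 2 = 0 by nra.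
  by rewrite sqrf_eq0 subr_eq0 => /eqP.
by congr pair => //; lra.
Qed.

Lemma bijective_to_sym (T : Type) (U : pointedType) (A : set T) (B : set U) (f : U -> T) :
  set_bij B A f -> bijective_to A B.
Proof. by move=> fB; exists (pinv B f); exact: bijpinv_bij. Qed.

Lemma straighten_ge a b : 0 <= b -> b <= (straighten (a, b)).1.
Proof. by move=> b0; rewrite lerDl mulr_ge0 ?sqr_ge0 // divr_ge0 //=; lra. Qed.

(** The defect from the boundary arc is a positive multiple of the defect from
    the unit circle. *)
Lemma straighten_level a b : 0 <= b ->
  b ^+ 2 + 2 * (straighten (a, b)).1 - 3 =
    (3 + b) / (1 + b) * (a ^+ 2 + b ^+ 2 - 1).
Proof. by move=> b0; rewrite /straighten /=; field; lra. Qed.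

Lemma straighten_disk : set_bij closed_quarter_disk (frame_domain 8) straighten.
Proof.
rewrite frame_domain8; apply: straighten_bij => [p []//|q [-> ->]//|[a b] /= a0 b0].
have k0 : 0 < (3 + b) / (1 + b) by apply: divr_gt0; lra.
have qE := straighten_level a b0; have qge := straighten_ge a b0.
split=> [[_ _ /= ab]|[_ _ /=]].
  split=> //=; rewrite -subr_le0 [X in X <= _]qE pmulr_rle0 //; lra.
rewrite -subr_le0 [X in X <= _]qE pmulr_rle0 // subr_le0 => ab.
by split.
Qed.

Lemma straighten_circle : set_bij closed_quarter_circle (frame_domain 7) straighten.
Proof.
rewrite frame_domain7; apply: straighten_bij => [p []//|q [-> ->]//|[a b] /= a0 b0].
have k0 : (3 + b) / (1 + b) != 0 by rewrite gt_eqF //; apply: divr_gt0; lra.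
have qE := straighten_level a b0; have qge := straighten_ge a b0.
split=> [[_ _ /= ab]|[_ _ /= q3]].
  by split=> //=; apply: subr0_eq; rewrite [LHS]qE ab subrr mulr0.
split=> //=; apply: subr0_eq; apply: (mulfI k0).
by rewrite mulr0 -qE; apply/eqP; rewrite subr_eq0; apply/eqP.
Qed.

End Shapes.

Theorem theorem6p2 (R : realType) :
  [/\ H R 3 3 = set0,
      H R 3 4 = set0,
      (exists X, moduli R 3 5 = [set X]),
      bijective_to (moduli R 3 6) (closure (quarter_circle R)) &
      bijective_to (moduli R 3 7) (closure (quarter_disk R))].
Proof.
have empty n : (n < 5)%N -> H R 3 n = set0.
  move=> n5; apply/seteqP; split=> // f /H_normal_frame [x [z [F [[_ _ _]]]]].
  by rewrite leqNgt -addnA ltn_addr //= addnS ltnS.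
split; [exact: empty|exact: empty| | |].
- have [psi [psi1 _ psi2]] := moduli_bij R 5.
  exists (psi (1, 1)); rewrite frame_domain6 in psi1 psi2.
  apply/seteqP; split=> [X /psi2 [_ -> <-]//|_ ->]; exact: psi1.
- have [psi psiB] := moduli_bij R 6.
  apply: (@bijective_to_sym _ _ _ _ (psi \o @straighten R)).
  rewrite closure_quarter_circle; exact: set_bij_comp (straighten_circle R) psiB.
- have [psi psiB] := moduli_bij R 7.
  apply: (@bijective_to_sym _ _ _ _ (psi \o @straighten R)).
  rewrite closure_quarter_disk; exact: set_bij_comp (straighten_disk R) psiB.
Qed.
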